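(* Let $A \subseteq \mathbb{R}^d$ and let $k$ be an integer with $0 \le k \le d$. If $\alpha \ge 0$, $\alpha \neq k$, is such that $d^\alpha(A) > 0$, then for almost every projection $P : \mathbb{R}^d \to \mathbb{R}^d$ with range $\mathbb{R}^k \times \{0\}^{d-k}$, $d^{\min(k,\alpha)}(PA) > 0$. In particular, for almost every such projection $P$, $$D(PA) \ge \min\big(k, D(A)\big)$$ and, if $D(A) > k$, then $d^k(PA) > 0$ for almost every such projection $P$.
   Context: A cube in $\mathbb{R}^d$ is a set $C = \prod_{i=1}^d [a_i, a_i+\ell)$ with $a \in \mathbb{R}^d$, $\ell>0$; its side length is $\|C\| = \ell$. For $A \subseteq \mathbb{R}^d$, $\lfloor A \rfloor \subseteq \mathbb{Z}^d$ is the set of elements of $A$ rounded down in each coordinate. For $\alpha \ge 0$, the $\alpha$-counting measure of $A$ is $$d^{\alpha}(A) = \limsup_{\|C\|\to\infty} \frac{|\lfloor A \rfloor \cap C|}{\|C\|^\alpha} := \lim_{\ell\to\infty} \sup_{\|C\| \ge \ell} \frac{|\lfloor A \rfloor \cap C|}{\|C\|^\alpha},$$ the supremum being over cubes $C \subseteq \mathbb{R}^d$, and the counting dimension is $D(A) = \inf\{\alpha \ge 0 \mid d^\alpha(A) = 0\}$. A projection of $\mathbb{R}^d$ is a linear map $P$ with $P^2 = P$ (not necessarily orthogonal). Let $G(d,d-k)$ be the Grassmannian of $(d-k)$-dimensional linear subspaces of $\mathbb{R}^d$ and $\gamma_{d,d-k}$ the unique $O(d)$-invariant Borel probability measure on it.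 A projection $P$ with range $R = \mathbb{R}^k\times\{0\}^{d-k}$ is determined by its null space, which belongs to $\{V \in G(d,d-k) \mid V \cap R = \{0\}\}$, an open subset of full $\gamma_{d,d-k}$-measure; every element of this set arises. ''Almost every projection with range $R$'' means: for all such projections except those whose null spaces lie in a $\gamma_{d,d-k}$-null set. *)

(* Defs.v *)
From HB Require Import structures.
From mathcomp Require Import all_boot all_order all_algebra.
From mathcomp Require Import all_classical all_reals all_analysis.

Set Implicit Arguments.
Unset Strict Implicit.
Unset Printing Implicit Defensive.

Import Order.TTheory GRing.Theory Num.Theory.
Import numFieldNormedType.Exports.

Local Open Scope classical_set_scope.
Local Open Scope ring_scope.

(* MathComp / MathComp-Analysis development.  R^d is the type 'rV[R]_d of row
   vectors, and square matrices act on it by multiplication on the right. *)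

Section Counting.
Context {R : realType} {d : nat}.
Implicit Types (A : set 'rV[R]_d) (a : 'rV[R]_d) (l alpha : R).

Definition cube a l : set 'rV[R]_d :=
  [set x | forall i, a 0 i <= x 0 i < a 0 i + l].

(* Z^d is viewed inside R^d. *)
Definition floor_set A : set 'rV[R]_d :=
  map_mx (fun t : R => (Num.floor t)%:~R) @` A.

Definition sup_density alpha A l : \bar R :=
  ereal_sup [set y | exists a s, [/\ 0 < s, l <= s &
    y = (counting (floor_set A `&` cube a s) * ((s `^ alpha)^-1)%:E)%E]].

(* d^alpha(A), possibly +oo; sup_density is nonincreasing in l, so that the
   limit exists. *)
Definition counting_measure alpha A : \bar R :=
  lim (sup_density alpha A l @[l --> +oo]).

(* The infimum is taken in the extended reals to avoid the convention
   inf set0 = 0 of real infima; the set contains every alpha > d. *)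
Definition counting_dim A : \bar R :=
  ereal_inf [set alpha%:E | alpha in
    [set alpha : R | 0 <= alpha /\ counting_measure alpha A = 0%E]].

End Counting.

Section Grassmannian.
Variables (R : realType) (d k : nat).

(* G(d, d - k).  It is indexed by the codimension k because measurable types
   are pointed and there is always a subspace of dimension d - k. *)
Definition grassmannian :=
  {V : {vspace 'rV[R]_d} | \dim V == (d - k)%N}.

Definition basis_mx (V : {vspace 'rV[R]_d}) : 'M[R]_(\dim V, d) :=
  \matrix_(i < \dim V) tnth (vbasis V) i.

(* The matrix of the orthogonal projection onto V: with B the matrix whose
   rows form a basis of V, it is B^T (B B^T)^-1 B. *)
Definition orth_proj_mx (V : {vspace 'rV[R]_d}) : 'M[R]_d :=
  let B := basis_mx V in B^T *m invmx (B *m B^T) *m B.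

Lemma grassmannian_inhabited : exists V : {vspace 'rV[R]_d}, \dim V == (d - k)%N.
Proof.
have dimE : \dim {:'rV[R]_d} = d by rewrite dimvf /dim /= mul1n.
pose X := take (d - k) (vbasis {:'rV[R]_d}).
have fX : free X.
  have := basis_free (vbasisP {:'rV[R]_d}).
  by rewrite -[X in free X -> _](cat_take_drop (d - k)) => /catl_free.
by exists <<X>>%VS; rewrite (eqP fX) size_takel // size_tuple dimE leq_subr.
Qed.

HB.instance Definition _ := Choice.on grassmannian.
HB.instance Definition _ := isPointed.Build grassmannian
  (exist _ (xchoose grassmannian_inhabited)
           (xchooseP grassmannian_inhabited)).

(* The usual topology of the Grassmannian: the one induced by identifying a
   subspace with its orthogonal projection (i.e. that of the metric
   |orth_proj_mx V - orth_proj_mx W|). *)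
HB.instance Definition _ := Topological.copy grassmannian
  (initial_topology (fun V : grassmannian => orth_proj_mx (val V))).

Definition borel_grassmannian := g_sigma_algebraType (@open grassmannian).

HB.instance Definition _ := Measurable.on borel_grassmannian.

(* The image of a set of subspaces under the linear map x |-> x *m g. *)
Definition grassmannian_image (g : 'M[R]_d) (U : set grassmannian) :
    set grassmannian :=
  [set V | exists2 W, U W & val V = (linfun (mulmxr g) @: val W)%VS].

(* There is exactly one O(d)-invariant Borel probability measure; it is
   characterized here rather than constructed. *)
Definition orthogonal_invariant (gamma : probability borel_grassmannian R) :=
  forall g : 'M[R]_d, g *m g^T = 1%:M ->
  forall U : set borel_grassmannian, measurable U ->
    gamma (grassmannian_image g U) = gamma U.

End Grassmannian.

Section Projections.
Context {R : realType} {d : nat}.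

(* P is a linear projection with range R^k x {0}^(d-k). *)
Definition projection_onto_coords (k : nat) (P : 'End('rV[R]_d)) : Prop :=
  (P \o P)%VF = P /\
  forall x : 'rV[R]_d,
    x \in limg P <-> forall i : 'I_d, (k <= i)%N -> x 0 i = 0.

Definition ae_projection (k : nat)
    (gamma : probability (borel_grassmannian R d k) R)
    (Q : 'End('rV[R]_d) -> Prop) : Prop :=
  {ae gamma, forall V : borel_grassmannian R d k,
    forall P : 'End('rV[R]_d),
      projection_onto_coords k P -> lker P = \val (V : grassmannian R d k) ->
      Q P}.

End Projections.

(* Main.v *)
Require Import Defs.
From HB Require Import structures.
From mathcomp Require Import all_boot all_order all_algebra finmap.
From mathcomp Require Import all_classical all_reals all_analysis.
From mathcomp Require Import measurable_realfun ring lra.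
Import Order.TTheory GRing.Theory Num.Theory.
Import numFieldNormedType.Exports.
Local Open Scope classical_set_scope.
Local Open Scope ring_scope.

(** Let [P] be the projection onto the first [k] coordinates with null space
    [V]. If [P p] and [P q] round down to the same integer point, then [p - q]
    lies within distance [sqrt d] of [V], because [p - q] differs from a vector
    of [V] by [P (p - q)], whose coordinates are smaller than 1. So a random
    projection produces few collisions as soon as a random subspace rarely
    passes near a given long vector, and few collisions mean many distinct image
    points, by the Cauchy-Schwarz inequality ([card_sq_le_collisions],
    [card_sq_le_projected_count]).

    The probability that [V] passes within a fixed distance of [w] is
    [O(|w|^-k)] ([measure_near_subspaces_le]). By orthogonal invariance this
    probability depends on [|w|] only and decreases with it, hence it is at most
    its average over the integer points [y] of a cube of side length comparable
    to [|w|]. That average can be computed for each [V] separately: a subspace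
    of dimension [d - k] passes near [O(N^(d-k))] of the [N^d] integer points of
    a cube of side length [N] ([card_lattice_near]).

    An energy argument asks for a Frostman-type bound, which [A] may violate:
    its [alpha]-counting measure may be infinite. Write [M n] for the largest
    number of points of [floor_set A] in a cube of side length [2^n]. The remedy
    is to look only at scales [n] at which [M n / 2^(n alpha)] is, up to a
    constant, at least as large as at all smaller scales
    ([near_record_indices]). Inside a maximal cube of such a scale, any cube of
    side length [2^m] contains at most [O(H 2^(m alpha))] points, where [H = M n
    / 2^(n alpha)], and summing the collision probabilities over dyadic annuli
    gives an expected number of colliding pairs of at most a constant times [M n
    * H * sum_(m <= n) 2^(m (alpha - k))]. This sum is a geometric series of
    ratio different from 1, since [alpha] is not [k]; it is therefore [O(2^(n
    (alpha - min k alpha)))], and Cauchy-Schwarz leaves at least a constant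
    times [2^(n min k alpha)] image points in a cube of side length comparable
    to [2^n].

    By Markov's inequality this fails, at a given scale and with the constant
    divided by [lam], with probability at most [1 / lam] ([exceptional_sets]). A
    projection with [counting_measure (min k alpha) (P A) = 0] fails for every
    [lam] at all but finitely many of the scales, which has probability zero
    ([negligible_eventually_bad]). The two statements on the counting dimension
    follow by letting [alpha] run through a sequence increasing to [min k (D
    A)], and by choosing [alpha] strictly between [k] and [D A]. *)

Set Implicit Arguments.
Unset Strict Implicit.
Unset Printing Implicit Defensive.

Local Notation floor_set := Defs.floor_set.

(** * Euclidean geometry of row vectors *)

Section Euclidean.
Context {R : realType} {d : nat}.
Implicit Types (x y u v w : 'rV[R]_d).

Definition dot x y : R := \sum_i x 0 i * y 0 i.
Definition sqnorm x : R := dot x x.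

Lemma dotE x y : (x *m y^T) 0 0 = dot x y.
Proof. by rewrite mxE; apply: eq_bigr => i _; rewrite mxE. Qed.

Lemma dotC x y : dot x y = dot y x.
Proof. by apply: eq_bigr => i _; rewrite mulrC. Qed.

Lemma dotDl x y z : dot (x + y) z = dot x z + dot y z.
Proof. by rewrite -big_split; apply: eq_bigr => i _; rewrite mxE mulrDl. Qed.

Lemma dotZl a x y : dot (a *: x) y = a * dot x y.
Proof. by rewrite mulr_sumr; apply: eq_bigr => i _; rewrite mxE mulrA. Qed.

Lemma dotNl x y : dot (- x) y = - dot x y.
Proof. by rewrite -scaleN1r dotZl mulN1r. Qed.

Lemma sqnorm_ge0 x : 0 <= sqnorm x.
Proof. by apply: sumr_ge0 => i _; rewrite -expr2 sqr_ge0. Qed.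

Lemma coord_le_sqnorm x i : x 0 i ^+ 2 <= sqnorm x.
Proof.
rewrite /sqnorm /dot (bigD1 i) //= expr2 lerDl.
by apply: sumr_ge0 => j _; rewrite -expr2 sqr_ge0.
Qed.

Lemma sqnorm_eq0 x : sqnorm x = 0 -> x = 0.
Proof.
move=> x0; apply/rowP => i; rewrite mxE; apply/eqP.
by rewrite -sqrf_eq0 eq_le sqr_ge0 andbT -x0 coord_le_sqnorm.
Qed.

Lemma sqnormZ a x : sqnorm (a *: x) = a ^+ 2 * sqnorm x.
Proof. by rewrite /sqnorm dotZl dotC dotZl mulrA expr2. Qed.

Lemma sqnormD x y : sqnorm (x + y) = sqnorm x + 2 * dot x y + sqnorm y.
Proof.
rewrite /sqnorm dotDl !(dotC _ (x + y)) !dotDl (dotC y x); ring.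
Qed.

Lemma sqnorm_orthogonal (g : 'M[R]_d) x :
  g *m g^T = 1%:M -> sqnorm (x *m g) = sqnorm x.
Proof.
by move=> gg; rewrite /sqnorm -!dotE trmx_mul mulmxA -(mulmxA x) gg mulmx1.
Qed.

(** The Householder reflection in the hyperplane bisecting [x] and [y] swaps
    them; this is all that transitivity of the orthogonal group on spheres
    requires. *)
Lemma orthogonal_transitive x y : sqnorm x = sqnorm y ->
  exists2 g : 'M[R]_d, g *m g^T = 1%:M & x *m g = y.
Proof.
move=> xy; have [<-|nxy] := eqVneq x y.
  by exists 1%:M; rewrite ?trmx1 mulmx1.
pose u := x - y.
have un0 : dot u u != 0.
  by apply: contra_neq nxy => /sqnorm_eq0 /eqP; rewrite subr_eq0 => /eqP.
have uxE : 2 * dot x u = dot u u.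
  move: xy; rewrite /sqnorm /u !dotDl !dotNl !(dotC _ (x - y)) !dotDl !dotNl.
  by rewrite (dotC y x) => ->; ring.
have uu : u *m u^T = (dot u u)%:M.
  by apply/matrixP => i j; rewrite !ord1 dotE mxE mulr1n.
pose c := 2 / dot u u.
exists (1%:M - c *: (u^T *m u)).
  have -> : (1%:M - c *: (u^T *m u))^T = 1%:M - c *: (u^T *m u).
    by rewrite raddfB /= trmx1 [(c *: _)^T]linearZ /= trmx_mul trmxK.
  rewrite mulmxBr mulmx1 mulmxBl mul1mx -scalemxAl -scalemxAr.
  rewrite mulmxA -(mulmxA u^T) uu mul_mx_scalar -scalemxAl !scalerA.
  have -> : c * (c * dot u u) = c + c by rewrite /c; field.
  by rewrite scalerDl opprB addrK subrK.
rewrite mulmxBr mulmx1 -scalemxAr mulmxA.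
have -> : x *m u^T = (dot x u)%:M.
  by apply/matrixP => i j; rewrite !ord1 dotE mxE mulr1n.
rewrite mul_scalar_mx scalerA.
have -> : c * dot x u = 1 by rewrite /c mulrAC uxE divff.
by rewrite scale1r /u opprB addrC subrK.
Qed.

(** If [u] is killed by the Gram matrix, then [u *m B] has norm zero. *)
Lemma gram_unitmx m (B : 'M[R]_(m, d)) :
  row_free B -> B *m B^T \in unitmx.
Proof.
move=> fB; rewrite -row_free_unit -kermx_eq0; apply/rowV0P => u /sub_kermxP.
move=> uBB; apply/eqP; rewrite -(mulmx_free_eq0 _ fB); apply/eqP/sqnorm_eq0.
by rewrite /sqnorm -dotE trmx_mul mulmxA -(mulmxA u) uBB mul0mx mxE.
Qed.

End Euclidean.

(** * Distance to a subspace *)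

Section OrthogonalProjection.
Context {R : realType} {d : nat}.
Implicit Types (w v : 'rV[R]_d) (V : {vspace 'rV[R]_d}).

Lemma mulmx_basis V (u : 'rV[R]_(\dim V)) :
  u *m basis_mx V = \sum_i u 0 i *: (vbasis V)`_i.
Proof.
rewrite mulmx_sum_row; apply: eq_bigr => i _.
by rewrite rowK (tnth_nth 0).
Qed.

Lemma mem_mulmx_basis V (u : 'rV[R]_(\dim V)) : u *m basis_mx V \in V.
Proof.
rewrite mulmx_basis; apply: memv_suml => i _; apply: memvZ.
by apply: vbasis_mem; apply: mem_nth; rewrite size_tuple.
Qed.

Lemma mem_basisP V v : v \in V -> exists u, v = u *m basis_mx V.
Proof.
move=> vV; exists (\row_i coord (vbasis V) i v).
by rewrite mulmx_basis {1}(coord_vbasis vV); apply: eq_bigr => i _; rewrite mxE.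
Qed.

Lemma row_free_basis V : row_free (basis_mx V).
Proof.
rewrite -kermx_eq0; apply/rowV0P => u /sub_kermxP; rewrite mulmx_basis => u0.
have /freeP fV := basis_free (vbasisP V).
by apply/rowP => i; rewrite mxE; apply: (fV (fun i => u 0 i)).
Qed.

Lemma orth_proj_mem V w : w *m orth_proj_mx V \in V.
Proof. by rewrite /orth_proj_mx /= !mulmxA mem_mulmx_basis. Qed.

Lemma orth_proj_dot V w v : v \in V -> dot (w - w *m orth_proj_mx V) v = 0.
Proof.
case/mem_basisP => u ->; set B := basis_mx V.
rewrite -dotE trmx_mul mulmxA mulmxBl /orth_proj_mx -/B !mulmxA.
rewrite -(mulmxA _ B B^T) mulmxKV ?subrr ?mul0mx ?mxE //.
exact/gram_unitmx/row_free_basis.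
Qed.

Lemma orth_proj_closest V w v :
  v \in V -> sqnorm (w - w *m orth_proj_mx V) <= sqnorm (w - v).
Proof.
move=> vV; have pV : w *m orth_proj_mx V - v \in V.
  by rewrite rpredB ?orth_proj_mem.
have -> : w - v = (w - w *m orth_proj_mx V) + (w *m orth_proj_mx V - v).
  by rewrite addrA subrK.
by rewrite [leRHS]sqnormD orth_proj_dot // mulr0 addr0 lerDl sqnorm_ge0.
Qed.

End OrthogonalProjection.

(** * Subspaces passing near a vector *)

Section Near.
Context {R : realType} {d k : nat}.
Implicit Types (w x y : 'rV[R]_d) (r : R).

(** The radius is measured by its square: [r] bounds the squared distance.
    Phrasing nearness by a witness in [V], and not by the orthogonal projection,
    makes invariance under linear isometries immediate. *)
Definition near_subspaces r w : set (borel_grassmannian R d k) :=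
  [set V | exists2 v, v \in val (V : grassmannian R d k) & sqnorm (w - v) <= r].

(** The orthogonal projection gives the nearest point, so nearness is a closed
    condition on the projection matrix and hence on the subspace. *)
Lemma near_subspacesE r w : near_subspaces r w =
  [set V | sqnorm (w - w *m orth_proj_mx (val (V : grassmannian R d k))) <= r].
Proof.
apply/seteqP; split=> V /=.
  by case=> v vV; apply: le_trans; exact: orth_proj_closest.
exists (w *m orth_proj_mx (\val (V : grassmannian R d k))) => //.
exact: orth_proj_mem.
Qed.

Lemma continuous_sqdist w :
  continuous (fun M : 'M[R]_d => sqnorm (w - w *m M)).
Proof.
have cE j : continuous (fun M : 'M[R]_d => (w - w *m M) 0 j).
  have -> : (fun M : 'M[R]_d => (w - w *m M) 0 j) =
            (fun M : 'M[R]_d => w 0 j - \sum_i w 0 i * M i j).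
    by apply/funext => M; rewrite !mxE.
  move=> M; apply: (@continuousB _ R^o); first exact: cst_continuous.
  move: M; apply: (continuous_big add_continuous) => i _ {}M.
  by apply: continuousM; [exact: cst_continuous|exact: coord_continuous].
apply: (continuous_big add_continuous) => j _ M.
by apply: continuousM; exact: cE.
Qed.

Lemma measurable_near_subspaces r w : measurable (near_subspaces r w).
Proof.
pose O : set (grassmannian R d k) := ~` near_subspaces r w.
suff oO : open O.
  rewrite -[near_subspaces r w]setCK; apply: measurableC.
  by apply: sub_sigma_algebra.
have cf := @continuous_sqdist w.
exists ((fun M : 'M[R]_d => sqnorm (w - w *m M)) @^-1` [set t | r < t]).
  by apply: open_comp; [move=> M _; exact: cf|exact: open_gt].
rewrite /O near_subspacesE; apply/seteqP; split=> V /=.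
  by move=> rV; apply/negP; rewrite -ltNge.
by move/negP; rewrite -ltNge.
Qed.

Lemma grassmannian_image_near (g : 'M[R]_d) r w : g *m g^T = 1%:M ->
  grassmannian_image g (near_subspaces r w) = near_subspaces r (w *m g).
Proof.
move=> gg; have ggT : g^T *m g = 1%:M by exact: mulmx1C.
have imE (W : {vspace 'rV[R]_d}) v :
    v \in W -> v *m g \in (linfun (mulmxr g) @: W)%VS.
  by move=> vW; rewrite -[v *m g](lfunE (mulmxr g)) memv_img.
apply/seteqP; split=> V /=.
  case=> W [v vW le_r] VE; exists (v *m g); first by rewrite VE imE.
  by rewrite -mulmxBl sqnorm_orthogonal.
case=> v vV le_r.
have dimV' : \dim (linfun (mulmxr g^T) @: val V) == (d - k)%N.
  rewrite limg_dim_eq; first exact: (valP V).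
  apply/eqP; rewrite -subv0; apply/subvP => x /memv_capP [_].
  rewrite memv_ker lfunE /= => /eqP xg0.
  by rewrite -[x]mulmx1 -ggT mulmxA xg0 mul0mx mem0v.
pose W : grassmannian R d k :=
  exist (fun U : {vspace _} => \dim U == (d - k)%N) _ dimV'.
exists W.
  exists (v *m g^T); first by rewrite /= -[v *m _](lfunE (mulmxr g^T)) memv_img.
  have -> : w - v *m g^T = (w *m g - v) *m g^T.
    by rewrite mulmxBl -mulmxA gg mulmx1.
  by rewrite sqnorm_orthogonal // trmxK.
rewrite /= -limg_comp.
have -> : (linfun (mulmxr g) \o linfun (mulmxr g^T))%VF = \1%VF
    :> 'End('rV[R]_d).
  by apply/lfunP => x; rewrite comp_lfunE !lfunE /= -mulmxA ggT mulmx1.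
by rewrite lim1g.
Qed.

Lemma near_subspacesZ a r w : a != 0 ->
  near_subspaces (a ^+ 2 * r) (a *: w) = near_subspaces r w.
Proof.
move=> a0; have a2 : 0 < a ^+ 2 by rewrite exprn_even_gt0.
apply/seteqP; split=> V /= [v vV le_r].
  exists (a^-1 *: v); first by rewrite memvZ.
  rewrite -(ler_pM2l a2) -sqnormZ scalerBr scalerA divff //.
  by rewrite scale1r.
by exists (a *: v); rewrite ?memvZ // -scalerBr sqnormZ ler_pM2l.
Qed.

Context (gamma : probability (borel_grassmannian R d k) R)
        (gamma_inv : orthogonal_invariant gamma).

(** By invariance the measure depends on the norm of the vector only, and
    shrinking a vector brings it closer to every subspace. *)
Lemma near_subspaces_antitone r x y : 0 <= r -> sqnorm y <= sqnorm x ->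
  (gamma (near_subspaces r x) <= gamma (near_subspaces r y))%E.
Proof.
move=> r0 yx; have [y0|yn0] := eqVneq (sqnorm y) 0.
  (* The zero vector belongs to every subspace. *)
  have -> : near_subspaces r y = setT.
    apply/seteqP; split=> // V _; exists 0; first exact: mem0v.
    by rewrite subr0 y0.
  by apply: le_measure; rewrite ?inE //; exact: measurable_near_subspaces.
have y_gt0 : 0 < sqnorm y by rewrite lt_def yn0 sqnorm_ge0.
pose a := Num.sqrt (sqnorm x / sqnorm y).
have a2E : a ^+ 2 = sqnorm x / sqnorm y.
  by rewrite sqr_sqrtr // divr_ge0 ?sqnorm_ge0.
have a2_ge1 : 1 <= a ^+ 2 by rewrite a2E ler_pdivlMr // mul1r.
have a0 : a != 0.
  by apply: contraTneq a2_ge1 => ->; rewrite expr0n /= ler10.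
have [g gg xg] : exists2 g : 'M[R]_d, g *m g^T = 1%:M & x *m g = a *: y.
  by apply: orthogonal_transitive; rewrite sqnormZ a2E divfK.
have mx := measurable_near_subspaces r x.
rewrite -(gamma_inv gg mx) (grassmannian_image_near _ _ gg) xg.
apply: le_measure; rewrite ?inE; try exact: measurable_near_subspaces.
(* [x] has the norm of [a *: y] with [1 <= a]: scaling back divides the distance
   by [a]. *)
rewrite -(near_subspacesZ r y a0) => V [v vV le_r]; exists v => //.
by apply: (le_trans le_r); rewrite ler_peMl.
Qed.

End Near.

(** * Lattice points near a subspace *)

Section GraphCoordinates.
Context {R : realType} {d : nat}.
Implicit Types (V : {vspace 'rV[R]_d}).

(** The identity matrix with one column replaced: only the diagonal entry of
    that column has a nonzero cofactor. *)
Lemma det_replace_col n (M : 'M[R]_n) (i : 'I_n) :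
  (forall a b, b != i -> M a b = (a == b)%:R) -> \det M = M i i.
Proof.
move=> ME; have cofE a : cofactor M a i = (\adj (1%:M : 'M[R]_n)) i a.
  rewrite mxE /cofactor; congr (_ * \det _); apply/matrixP => x y.
  by rewrite !mxE ME // eq_sym neq_lift.
rewrite (expand_det_col M i) (bigD1 i) //= cofE adj1 mxE eqxx mulr1.
rewrite big1 ?addr0 //.
by move=> a ai; rewrite cofE adj1 mxE eq_sym (negPf ai) mulr0.
Qed.

(** Every subspace is the graph, over suitably chosen coordinates [f], of a
    linear map with small coefficients.  Choose [f] so that the corresponding
    maximal minor of a basis is largest in absolute value; by Cramer's rule each
    coefficient is a quotient of two such minors, with the largest one in the
    denominator. *)
Lemma graph_coordinates V :
  exists (f : 'I_(\dim V) -> 'I_d) (M : 'M[R]_(\dim V, d)),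
    (forall i j, `|M i j| <= 1) /\
    (forall v, v \in V -> v = (\row_i v 0 (f i)) *m M).
Proof.
set m := \dim V; pose B : 'M[R]_(m, d) := basis_mx V.
pose minor (f : {ffun 'I_m -> 'I_d}) := `|\det (colsub f B)|.
have fB : row_full B^T by rewrite /row_full mxrank_tr; exact: row_free_basis.
pose f0 : {ffun 'I_m -> 'I_d} := [ffun i => fullrankfun fB i].
have f0_gt0 : 0 < minor f0.
  rewrite normr_gt0 -unitfE -unitmxE -unitmx_tr.
  have -> : (colsub f0 B)^T = rowsub (fullrankfun fB) B^T.
    by apply/matrixP => i j; rewrite !mxE ffunE.
  exact: fullrowsub_unit.
have [f _ fmax] := @arg_maxP _ R _ f0 predT minor isT.
have {}fmax g : minor g <= minor f by exact: fmax.
have f_gt0 : 0 < minor f by apply: lt_le_trans f0_gt0 (fmax _).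
pose D := colsub f B.
have Du : D \in unitmx by rewrite unitmxE unitfE -normr_gt0.
pose M := invmx D *m B.
have DM : D *m M = B by rewrite mulmxA mulmxV // mul1mx.
have Mf a b : M a (f b) = (a == b)%:R.
  have /matrixP/(_ a b) : colsub f M = 1%:M.
    rewrite -(mulVmx Du); apply/matrixP => x y; rewrite !mxE.
    by apply: eq_bigr => z _; rewrite !mxE.
  by rewrite !mxE.
exists f, M; split => [i j|v /mem_basisP [u ->]].
  pose f' : {ffun 'I_m -> 'I_d} := [ffun b => if b == i then j else f b].
  (* Exchanging the [i]-th coordinate of [f] for [j] multiplies the minor by
     [M i j]. *)
  have := fmax f'; rewrite /minor.
  have -> : colsub f' B = D *m colsub f' M.
    rewrite -DM; apply/matrixP => x y; rewrite !mxE.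
    by apply: eq_bigr => z _; rewrite !mxE.
  rewrite det_mulmx normrM ger_pMr //.
  rewrite (@det_replace_col _ _ i) ?mxE ?ffunE ?eqxx // => a b /negPf bi.
  by rewrite mxE ffunE bi Mf.
have -> : \row_i (u *m B) 0 (f i) = u *m D.
  by apply/rowP => i; rewrite !mxE; apply: eq_bigr => z _; rewrite !mxE.
by rewrite -mulmxA DM.
Qed.

End GraphCoordinates.

Section LatticeCount.
Context {R : realType} {d : nat}.
Implicit Types (V : {vspace 'rV[R]_d}).

Definition lattice_point N (y : {ffun 'I_d -> 'I_N}) : 'rV[R]_d :=
  \row_i (y i)%:R.

(** A point near [V] is determined, up to bounded error, by its [\dim V]
    coordinates [f] over which [V] is a graph.  The bounded error takes
    boundedly many values after rounding, which gives an injection into a set of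
    the stated size. *)
Lemma card_lattice_near V (N c : nat) (r : R) : r <= c%:R ^+ 2 ->
  (#|[set y : {ffun 'I_d -> 'I_N} |
       `[< exists2 v, v \in V & (sqnorm (lattice_point y - v) <= r)%R >] ]%SET|
   <= N ^ \dim V * (2 * ((\dim V).+1 * c)).+1 ^ d)%N.
Proof.
move=> rc; have [f [M [M1 MV]]] := graph_coordinates V.
set S := finset _; set m := \dim V in f M M1 MV *.
pose b := (m.+1 * c)%N.
(* The deviation of a point from the point of [V] with the same
   [f]-coordinates. *)
pose e (y : {ffun 'I_d -> 'I_N}) : 'rV[R]_d :=
  lattice_point y - (\row_i lattice_point y 0 (f i)) *m M.
have e_small y j : y \in S -> `|e y 0 j| <= b%:R.
  rewrite inE => /asboolP [v vV le_r].
  have dist_c i : `|lattice_point y 0 i - v 0 i| <= c%:R.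
    rewrite -(ler_pXn2r (n := 2)) ?nnegrE // real_normK ?num_real //.
    apply: le_trans rc; apply: le_trans le_r.
    by have := coord_le_sqnorm (lattice_point y - v) i; rewrite !mxE.
  have -> : e y 0 j = (lattice_point y 0 j - v 0 j)
      - \sum_i (lattice_point y 0 (f i) - v 0 (f i)) * M i j.
    rewrite {1}(MV _ vV) /e !mxE -addrA; congr (_ + _).
    rewrite -opprD; congr (- _); rewrite -big_split; apply: eq_bigr => i _.
    by rewrite !mxE /=; ring.
  apply: (le_trans (ler_normB _ _)); rewrite /b mulSn natrD lerD //.
  apply: (le_trans (ler_norm_sum _ _ _)).
  rewrite natrM mulr_natl -[X in _ *+ X]card_ord -sumr_const.
  apply: ler_sum => i _; rewrite normrM -[leRHS]mulr1.
  by apply: ler_pM.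
pose h (y : {ffun 'I_d -> 'I_N}) :
    {ffun 'I_m -> 'I_N} * {ffun 'I_d -> 'I_(2 * b).+1} :=
  ([ffun i => y (f i)], [ffun j => inord (absz (Num.floor (e y 0 j) + b%:Z))]).
(* When the [f]-coordinates agree, [e y] and [e y'] differ by the integer vector
   [y - y'], so their floors differ by it too. *)
have h_inj : {in S &, injective h}.
  move=> y y' yS y'S [/ffunP hf /ffunP he]; apply/ffunP => j; apply/val_inj.
  have base : \row_i lattice_point y 0 (f i) = \row_i lattice_point y' 0 (f i).
    by apply/rowP => i; rewrite !mxE; have := hf i; rewrite !ffunE => ->.
  have floor_bd z : z \in S ->
      0 <= Num.floor (e z 0 j) + b%:Z /\
      Num.floor (e z 0 j) + b%:Z <= (2 * b)%:Z.
    move=> zS; have := e_small z j zS; rewrite ler_norml => /andP[lo hi].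
    split.
      rewrite -[b%:Z]opprK subr_ge0 floor_ge_int_tmp; apply: le_trans lo.
      by rewrite mulrNz.
    rewrite mulSn mul1n PoszD lerD2r -(ler_int R).
    by apply: le_trans (floor_le _) hi.
  have := he j; rewrite !ffunE => /(congr1 val) /=.
  have [y1 y2] := floor_bd _ yS; have [y3 y4] := floor_bd _ y'S.
  rewrite !inordK; try by rewrite ltnS -lez_nat gez0_abs.
  move/(congr1 Posz); rewrite !gez0_abs // => /addIr.
  rewrite /e base ![(lattice_point _ - _) 0 j]mxE ![lattice_point _ 0 j]mxE.
  rewrite !floorDzr ?natr_int // => /addIr.
  by rewrite ![_%:R]pmulrn !intrKfloor => -[].
rewrite -(card_in_imset h_inj).
apply: leq_trans (max_card _) _.
by rewrite card_prod !card_ffun !card_ord leqnn.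
Qed.

End LatticeCount.

(** * Counting how many of finitely many events occur *)

Section SumOfIndicators.
Context {disp : measure_display} {T : measurableType disp} {R : realType}.
Context (P : probability T R) {I : finType} (U : I -> set T).
Context (mU : forall i, measurable (U i)).

Definition multiplicity (t : T) : R := \sum_i \1_(U i) t.

Lemma measurable_multiplicity : measurable_fun setT multiplicity.
Proof. by apply: measurable_sum => i; exact: measurable_indic. Qed.

Lemma multiplicity_ge0 t : 0 <= multiplicity t.
Proof. by apply: sumr_ge0 => i _; rewrite indicE ler0n. Qed.

Lemma multiplicityE t : multiplicity t = #|[set i | `[< U i t >]]%SET|%:R.
Proof.
rewrite /multiplicity -sum1_card natr_sum [RHS]big_mkcond /=.
apply: eq_bigr => i _; rewrite indicE inE; case: asboolP => Ut.
  by rewrite mem_set.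
by rewrite memNset.
Qed.

Lemma integral_multiplicity :
  (\int[P]_t (multiplicity t)%:E = \sum_i P (U i))%E.
Proof.
under eq_integral do rewrite /multiplicity -sumEFin.
rewrite ge0_integral_sum //; last first.
  by move=> i; apply/measurable_EFinP; exact: measurable_indic.
by apply: eq_bigr => i _; rewrite integral_indic // setIT.
Qed.

Lemma sum_measure_le (c : R) :
  (forall t, multiplicity t <= c) -> (\sum_i P (U i) <= c%:E)%E.
Proof.
move=> Xc; rewrite -integral_multiplicity.
apply: (@le_trans _ _ (\int[P]_t (cst c%:E t))%E).
  apply: ge0_le_integral => //.
  - by move=> t _; rewrite lee_fin multiplicity_ge0.
  - by apply/measurable_EFinP; exact: measurable_multiplicity.
  - by move=> t _; rewrite lee_fin Xc.
by rewrite integral_cst // [X in (_ * X)%E]probability_setT mule1.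
Qed.

Lemma measurable_multiplicity_gt (s : R) :
  measurable [set t | s < multiplicity t].
Proof.
rewrite -[X in measurable X]setTI.
have -> : [set t | s < multiplicity t] = multiplicity @^-1` `]s, +oo[%classic.
  by apply/seteqP; split=> t /=; rewrite in_itv /= andbT.
exact: measurable_multiplicity.
Qed.

Lemma multiplicity_markov (lam E : R) : 0 < lam -> 0 < E ->
  (\sum_i P (U i) <= E%:E)%E ->
  (P [set t | (lam * E < multiplicity t)%R] <= (lam^-1)%:E)%E.
Proof.
move=> lam0 E0; rewrite -integral_multiplicity => XE.
have mB := measurable_multiplicity_gt (lam * E).
have lE : 0 < lam * E by exact: mulr_gt0.
rewrite -(@lee_pmul2l _ (lam * E)%:E) ?lte_fin //.
rewrite -EFinM mulrAC divff ?gt_eqF // mul1r; apply: le_trans XE.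
rewrite -[X in P X]setIT -integral_indic //.
have m1 : measurable_fun setT
    (fun t => (\1_[set t | lam * E < multiplicity t] t)%:E : \bar R).
  by apply/measurable_EFinP; exact: measurable_indic.
rewrite -ge0_integralZl //; last by rewrite lee_fin ltW.
apply: ge0_le_integral => //.
- by move=> t _; rewrite -EFinM lee_fin mulr_ge0 ?(ltW lE) // indicE ler0n.
- apply/measurable_EFinP.
  by apply: measurable_funM => //; exact: measurable_indic.
- by apply/measurable_EFinP; exact: measurable_multiplicity.
move=> t _; rewrite -EFinM lee_fin indicE.
have [/set_mem /= tB|_] := boolP (_ \in _).
  by rewrite mulr1 ltW.
by rewrite mulr0 multiplicity_ge0.
Qed.

End SumOfIndicators.

(** * How often a random subspace passes near a given vector *)

Section NearMeasure.
Context {R : realType} {d k : nat} (k_le_d : (k <= d)%N).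
Context (gamma : probability (borel_grassmannian R d k) R)
        (gamma_inv : orthogonal_invariant gamma).

Lemma sqnorm_lattice_point N (y : {ffun 'I_d -> 'I_N}) :
  sqnorm (lattice_point y : 'rV[R]_d) <= (d * N ^ 2)%:R.
Proof.
rewrite -[X in (X * _)%N]card_ord -sum_nat_const natr_sum.
apply: ler_sum => i _; rewrite mxE -natrM ler_nat -mulnn.
by rewrite leq_mul // ltnW.
Qed.

(** The factor [2^-(m k)] comes from averaging over the lattice points of a cube
    of side length [2^m].  Their norm may exceed that of [w], so [w] and the
    radius are first scaled by [2 d]. *)
Lemma measure_near_subspaces_le : exists2 C : R, 1 <= C &
  forall (w : 'rV[R]_d) m, (m = 0%N \/ exists i, 2 ^+ m <= 2 * `|w 0 i|) ->
    (gamma (near_subspaces d%:R w) <= (C * 2 ^- (m * k))%:E)%E.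
Proof.
pose c := (2 * d ^ 2)%N; pose K := (2 * ((d - k).+1 * c)).+1.
exists (K ^ d)%:R; first by rewrite ler1n expn_gt0.
move=> w m [->|[i wi]].
  rewrite mul0n expr0 invr1 mulr1; apply: le_trans (probability_le1 _ _) _.
    exact: measurable_near_subspaces.
  by rewrite lee_fin ler1n expn_gt0.
have d0 : (0 < d)%N by apply: leq_ltn_trans (ltn_ord i).
pose a : R := 2 * d%:R; pose N := (2 ^ m)%N.
have a0 : a != 0 by rewrite mulf_neq0 // pnatr_eq0 // -lt0n.
rewrite -(near_subspacesZ _ _ a0).
set p := gamma _.
have step (y : {ffun 'I_d -> 'I_N}) :
    (p <= gamma (near_subspaces (a ^+ 2 * d%:R) (lattice_point y)))%E.
  apply: (near_subspaces_antitone gamma_inv).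
    by rewrite mulr_ge0 ?sqr_ge0.
  apply: le_trans (sqnorm_lattice_point y) _.
  have le1 : (2 ^+ m) ^+ 2 <= 4 * sqnorm w.
    apply: (@le_trans _ _ ((2 * `|w 0 i|) ^+ 2)).
      by rewrite ler_pXn2r ?nnegrE ?exprn_ge0 // mulr_ge0.
    rewrite exprMn real_normK ?num_real // -natrX ler_pM2l //.
    exact: coord_le_sqnorm.
  rewrite sqnormZ natrM !natrX /a exprMn.
  have d1 : 1 <= d%:R :> R by rewrite ler1n.
  have h1 : 0 <= d%:R * (4 * sqnorm w - 2 ^+ m ^+ 2).
    by rewrite mulr_ge0 ?subr_ge0.
  have h2 : 0 <= d%:R * (d%:R - 1) * sqnorm w.
    by rewrite !mulr_ge0 ?sqnorm_ge0 ?subr_ge0.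
  rewrite mulrC; move: h1 h2; set D := d%:R; set s := sqnorm w.
  by set X := (2 ^+ m) ^+ 2; rewrite !expr2; lra.
have mN (y : {ffun 'I_d -> 'I_N}) := @measurable_near_subspaces R d k
  (a ^+ 2 * d%:R) (lattice_point y).
(* [c ^ 2] dominates the scaled squared radius [(2 d) ^ 2 * d]. *)
have : (\sum_(y : {ffun 'I_d -> 'I_N}) p <= (N ^ (d - k) * K ^ d)%:R%:E)%E.
  apply: le_trans (@sum_measure_le _ _ _ gamma _ _ mN _ _).
    by apply: lee_sum => y _.
  move=> V; rewrite multiplicityE ler_nat.
  have dimV : \dim (\val (V : grassmannian R d k)) = (d - k)%N.
    by apply/eqP; exact: (valP (V : grassmannian R d k)).
  rewrite -[X in (_ ^ X * _)%N]dimV.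
  apply: leq_trans (@card_lattice_near R d _ N c (a ^+ 2 * d%:R) _) _; last first.
    by rewrite dimV.
  have le_c : ((2 * d) ^ 2 * d <= c ^ 2)%N.
    have -> : (c ^ 2 = (2 * d) ^ 2 * (d * d))%N.
      by rewrite /c -[(d ^ 2)%N]mulnn mulnA expnMn mulnn.
    by rewrite leq_mul2l leq_pmulr ?orbT.
  by rewrite /a -natrM -!natrX -natrM ler_nat.
have p_fin : p \is a fin_num.
  by rewrite fin_num_measure //; exact: measurable_near_subspaces.
rewrite -(fineK p_fin) sumEFin !lee_fin sumr_const card_ffun !card_ord.
move=> le_p.
have N0 : (0 < (N ^ k)%:R :> R) by rewrite ltr0n !expn_gt0.
have Nd0 : (0 < (N ^ (d - k))%:R :> R) by rewrite ltr0n !expn_gt0.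
rewrite exprM -[2]/(2%:R) -!natrX -/N.
rewrite ler_pdivlMr // -(ler_pM2r Nd0) -mulrA -natrM -expnD subnKC //.
by rewrite mulr_natr -natrM mulnC.
Qed.

End NearMeasure.

(** * Counting measures through dyadic cubes *)

Section Counting.
Context {R : realType} {d : nat}.
Implicit Types (A : set 'rV[R]_d) (a b x : 'rV[R]_d) (s l alpha : R).

Definition floor_vec x : 'rV[R]_d := map_mx (fun t : R => (Num.floor t)%:~R) x.

Definition cube_count A a s : nat := #|` fset_set (floor_set A `&` cube a s)|.

Lemma floor_set_cube_sub A a s n : s <= n%:R ->
  exists2 F : {fset 'rV[R]_d}, (#|` F| <= n.+1 ^ d)%N &
    floor_set A `&` cube a s `<=` [set` F].
Proof.
move=> sn.
pose g (f : {ffun 'I_d -> 'I_n.+1}) : 'rV[R]_d :=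
  \row_i (Num.floor (a 0 i) + (f i : nat)%:Z)%:~R.
exists [fset g f | f in [set: {ffun 'I_d -> 'I_n.+1}]%SET]%fset.
  apply: leq_trans (leq_imfset_card _ _ _) _.
  by rewrite -cardE cardsT card_ffun !card_ord.
move=> _ [[x Ax <-] cx] /=; apply/imfsetP => /=.
pose e i : int := Num.floor (x 0 i) - Num.floor (a 0 i).
have bd i : 0 <= e i <= n%:Z.
  have := cx i; rewrite /e !mxE => /andP[lo hi]; apply/andP; split.
    by rewrite subr_ge0 -(ler_int R) (le_trans (floor_le _) lo).
  rewrite -ltzD1 -(ltr_int R) intrB intrD.
  have := floorD1_gt (a 0 i); rewrite intrD.
  by move: lo hi sn; set p := (Num.floor (x 0 i))%:~R; lra.
(* The offsets [e i] are natural numbers at most [n]. *)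
exists [ffun i => inord `|e i|%N].
  by rewrite inE.
apply/rowP => i; rewrite !mxE ffunE.
have /andP[p0 pn] := bd i.
rewrite inordK ?ltnS -?lez_nat gez0_abs //.
by rewrite /e addrC subrK.
Qed.

Lemma finite_floor_cube A a s : finite_set (floor_set A `&` cube a s).
Proof.
have [F _ sF] := @floor_set_cube_sub A a s (Num.truncn s).+1
  (ltW (truncnS_gt s)).
exact: sub_finite_set sF (finite_fset F).
Qed.

Lemma cube_count_le A a s n : s <= n%:R -> (cube_count A a s <= n.+1 ^ d)%N.
Proof.
move=> /floor_set_cube_sub - /(_ A a) [F cF sF]; apply: leq_trans cF.
apply: fsubset_leq_card; apply/fsubsetP => x.
by rewrite in_fset_set ?inE; [move/sF|exact: finite_floor_cube].
Qed.

Lemma cube_count_mono A A' a a' s s' :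
  floor_set A `&` cube a s `<=` floor_set A' `&` cube a' s' ->
  (cube_count A a s <= cube_count A' a' s')%N.
Proof.
move=> sub; apply: fsubset_leq_card; apply/fsubsetP => x.
by rewrite !in_fset_set ?inE; [exact: sub|exact: finite_floor_cube..].
Qed.

(** The number of points in a cube is a natural number bounded in terms of the
    side length, so the supremum over such cubes is attained. *)
Lemma max_cube_count A s :
  exists b, forall a, (cube_count A a s <= cube_count A b s)%N.
Proof.
pose Q n := `[< exists a, cube_count A a s = n >].
have exQ : exists n, Q n by exists (cube_count A 0 s); apply/asboolP; exists 0.
have bdQ n : Q n -> (n <= (Num.truncn s).+2 ^ d)%N.
  by move/asboolP => [a <-]; apply: cube_count_le; exact: ltW (truncnS_gt s).
case: (ex_maxnP exQ bdQ) => n /asboolP [b bn] nmax.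
by exists b => a; rewrite bn; apply: nmax; apply/asboolP; exists a.
Qed.

Lemma countingE A a s :
  counting (floor_set A `&` cube a s) = (cube_count A a s)%:R%:E :> \bar R.
Proof. by rewrite /counting asboolT //; exact: finite_floor_cube. Qed.

Lemma sup_density_nonincreasing alpha A : nonincreasing_fun (sup_density alpha A).
Proof.
move=> l l' ll'; apply: ereal_sup_le => y [a [s [s0 ls ->]]].
by exists a, s; split => //; exact: le_trans ll' ls.
Qed.

Lemma counting_measureE alpha A :
  counting_measure alpha A = ereal_inf (range (sup_density alpha A)).
Proof.
apply/cvg_lim => //; apply: nonincreasing_cvge.
exact: sup_density_nonincreasing.
Qed.

Lemma sup_density_ge alpha A l a s : 0 < s -> l <= s ->
  (((cube_count A a s)%:R / s `^ alpha)%:E <= sup_density alpha A l)%E.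
Proof.
by move=> s0 ls; apply: ereal_sup_ubound; exists a, s; rewrite countingE -EFinM.
Qed.

Lemma sup_density_ge0 alpha A l : (0 <= sup_density alpha A l)%E.
Proof.
have s0 : 0 < Order.max 1 l by rewrite lt_max ltr01.
have ls : l <= Order.max 1 l by rewrite le_max lexx orbT.
apply: le_trans (sup_density_ge alpha A 0 s0 ls).
by rewrite lee_fin divr_ge0 ?powR_ge0.
Qed.

Lemma counting_measure_ge0 alpha A : (0 <= counting_measure alpha A)%E.
Proof.
rewrite counting_measureE; apply: le_ereal_inf_tmp => _ [l _ <-].
exact: sup_density_ge0.
Qed.

Lemma counting_measure_gt0_intro alpha A (c : R) : 0 < c ->
  (forall l, exists a s, [/\ 0 < s, l <= s &
     c * s `^ alpha <= (cube_count A a s)%:R]) ->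
  (0 < counting_measure alpha A)%E.
Proof.
move=> c0 H; rewrite counting_measureE; apply: (@lt_le_trans _ _ c%:E).
  by rewrite lte_fin.
apply: le_ereal_inf_tmp => _ [l _ <-]; have [a [s [s0 ls le_c]]] := H l.
apply: le_trans (sup_density_ge alpha A a s0 ls).
by rewrite lee_fin ler_pdivlMr // powR_gt0.
Qed.

(** Replacing an arbitrary cube by a cube of dyadic side length costs a factor
    [2 `^ alpha]. *)
Lemma counting_measure_gt0_dyadic alpha A : 0 <= alpha ->
  (0 < counting_measure alpha A)%E ->
  exists2 c : R, 0 < c & forall n0, exists n a, (n0 <= n)%N /\
    c * (2 `^ alpha) ^+ n <= (cube_count A a (2 ^+ n))%:R.
Proof.
move=> al0; rewrite counting_measureE => inf_gt0.
have [c c0 c_inf] : exists2 c : R, 0 < c &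
    (c%:E < ereal_inf (range (sup_density alpha A)))%E.
  move: inf_gt0; case: (ereal_inf _) => [r| |] // r0.
    by exists (r / 2); rewrite ?lte_fin; move: r0; rewrite lte_fin; lra.
  by exists 1; rewrite ?ltry.
exists (c / 2 `^ alpha); first by rewrite divr_gt0 ?powR_gt0.
move=> n0.
have : (c%:E < sup_density alpha A (2 ^+ n0))%E.
  by apply: lt_le_trans c_inf _; apply: ereal_inf_lbound; exists (2 ^+ n0).
case/ereal_sup_gt => _ [a [s [s0 ls ->]]].
rewrite countingE -EFinM lte_fin ltr_pdivlMr ?powR_gt0 // => c_lt.
have exn : exists n, s <= 2 ^+ n.
  exists (Num.truncn s).+1; apply: (le_trans (ltW (truncnS_gt s))).
  by rewrite -natrX ler_nat ltnW // ltn_expl.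
case: (ex_minnP exn) => n sn nmin.
have n2s : 2 ^+ n <= 2 * s.
  case: n nmin sn => [|n] nmin sn.
    have : 1 <= 2 ^+ n0 :> R by rewrite exprn_ege1 ?ler1n.
    by rewrite expr0; lra.
  rewrite exprS ler_pM2l //; have [//|/ltW /nmin] := leP (2 ^+ n) s.
  by rewrite ltnn.
exists n, a; split.
  by have := le_trans ls sn; rewrite -!natrX ler_nat leq_exp2l.
have -> : (2 `^ alpha) ^+ n = (2 ^+ n) `^ alpha :> R.
  by rewrite -!powR_mulrn ?powR_ge0 // -!powRrM mulrC.
apply: (@le_trans _ _ (cube_count A a s)%:R); last first.
  rewrite ler_nat; apply: cube_count_mono => x [xA xs]; split => // i.
  by have /andP[-> h] := xs i; apply: (lt_le_trans h); rewrite lerD2l.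
apply: le_trans (ltW c_lt); rewrite -mulrA ler_pM2l // ler_pdivrMl ?powR_gt0 //.
rewrite -powRM ?(ltW s0) //; apply: ge0_ler_powR => //; rewrite nnegrE.
  by rewrite exprn_ge0.
by rewrite mulr_ge0 // ltW.
Qed.

(** Only cubes of side length at least 1 matter in the limit, and for them the
    normalizing power increases with the exponent. *)
Lemma counting_measure_antitone alpha beta A : alpha <= beta ->
  (counting_measure beta A <= counting_measure alpha A)%E.
Proof.
move=> ab; rewrite !counting_measureE; apply: le_ereal_inf_tmp => _ [l _ <-].
apply: (@le_trans _ _ (sup_density beta A (Order.max 1 l))).
  by apply: ereal_inf_lbound; exists (Order.max 1 l).
apply: ge_ereal_sup => _ [a [s [s0 ls ->]]].
have ls' : l <= s by apply: le_trans ls; rewrite le_max lexx orbT.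
apply: le_trans (sup_density_ge alpha A a s0 ls').
rewrite countingE -!EFinM lee_fin ler_wpM2l // lef_pV2 ?posrE ?powR_gt0 //.
by rewrite ler_powR // (le_trans _ ls) // le_max lexx.
Qed.

End Counting.

(** * Scales of nearly maximal density, geometric sums *)

Section Sequences.
Context {R : realType}.

(** If the sequence is bounded by [B], every index with [c <= u n] will do with
    [kappa = c / B].  Otherwise it exceeds all its previous values infinitely
    often, and these records do with [kappa = 1]. *)
Lemma near_record_indices (u : nat -> R) (c : R) : 0 < c ->
  (forall n0, exists n, (n0 <= n)%N /\ c <= u n) ->
  exists2 kappa : R, 0 < kappa <= 1 &
    forall n0, exists n, [/\ (n0 <= n)%N, 0 < u n &
      forall j, (j <= n)%N -> kappa * u j <= u n].
Proof.
move=> c0 uc; have [[B uB]|nB] := pselect (exists B, forall n, u n <= B).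
  have cB : c <= B by have [n [_ cn]] := uc 0%N; apply: le_trans cn (uB n).
  have B0 : 0 < B by exact: lt_le_trans cB.
  exists (c / B); first by rewrite divr_gt0 //= ler_pdivrMr // mul1r.
  move=> n0; have [n [n0n cn]] := uc n0; exists n; split=> //.
    exact: lt_le_trans c0 cn.
  move=> j _; apply: le_trans cn; rewrite mulrAC ler_pdivrMr // ler_pM2l //.
(* The first value above all [u j] with [j < n0] is a record. *)
exists 1; first by rewrite ltr01 lexx.
move=> n0; pose top := \big[Order.max/0]_(j < n0) u j.
have exn : exists n, top < u n.
  apply: contrapT => h; apply: nB; exists top => n.
  by rewrite leNgt; apply/negP => hn; apply: h; exists n.
case: (ex_minnP exn) => n topn nmin; exists n; split.
- rewrite leqNgt; apply/negP => nn0; move: topn; apply/negP; rewrite -leNgt.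
  exact: (le_bigmax _ (fun j : 'I_n0 => u j) (Ordinal nn0)).
- by apply: le_lt_trans topn; rewrite /top bigmax_idl le_max lexx.
move=> j; rewrite mul1r leq_eqVlt => /orP[/eqP -> //|jn].
apply: ltW; apply: le_lt_trans topn; rewrite leNgt; apply/negP => /nmin.
by rewrite leqNgt jn.
Qed.

Lemma geometric_sum_le (q : R) : 0 < q -> q != 1 ->
  exists2 c : R, 0 < c & forall n,
    \sum_(m < n.+2) q ^+ m <= c * (Order.max 1 q) ^+ n.
Proof.
move=> q0 q1; have [q_lt1|q_gt1|/eqP] := ltgtP q 1; last by rewrite (negPf q1).
  exists (1 - q)^-1; first by rewrite invr_gt0 subr_gt0.
  move=> n; rewrite expr1n mulr1 -(ler_pM2l (x := 1 - q)) ?subr_gt0 //.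
  rewrite divff ?subr_eq0 ?gt_eqF // -opprB mulNr -subrX1 opprB lerBlDr lerDl.
  by rewrite exprn_ge0 // ltW.
exists (q ^+ 2 / (q - 1)); first by rewrite divr_gt0 ?exprn_gt0 ?subr_gt0.
move=> n; rewrite -(ler_pM2l (x := q - 1)) ?subr_gt0 // -subrX1.
have -> : (q - 1) * (q ^+ 2 / (q - 1) * q ^+ n) = q ^+ n.+2.
  by rewrite mulrA mulrCA divff ?mulr1 -?exprD // gt_eqF // subr_gt0.
by rewrite lerBlDr lerDl.
Qed.

End Sequences.

(** * Collisions and energy *)

(** The Cauchy-Schwarz inequality for the cardinalities of the fibers of [h],
    whose squares add up to the number of colliding pairs. *)
Lemma card_sq_le_collisions (I T : finType) (h : I -> T) :
  (#|I| ^ 2 <= #|T| * \sum_(i : I) \sum_(j : I) (h i == h j))%N.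
Proof.
pose fiber b := #|[set i | h i == b]%SET|.
have cardI : #|I| = (\sum_b fiber b)%N.
  rewrite -sum1_card (partition_big h predT) //=; apply: eq_bigr => b _.
  by rewrite /fiber -sum1_card; apply: eq_bigl => i; rewrite inE.
have -> : (\sum_(i : I) \sum_(j : I) (h i == h j) = \sum_b fiber b ^ 2)%N.
  rewrite (partition_big h predT) //=; apply: eq_bigr => b _.
  rewrite (eq_bigr (fun=> fiber b)) => [|i /eqP ->]; last first.
    rewrite /fiber -sum1_card big_mkcond /= [RHS]big_mkcond /=.
    by apply: eq_bigr => j _; rewrite inE eq_sym; case: eqP.
  rewrite sum_nat_const; congr (_ * _)%N.
  by apply: eq_card => i; rewrite inE.
rewrite -(leq_pmul2l (m := 2)) // cardI -mulnn big_distrlr /= big_distrr /=.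
rewrite (eq_bigr (fun b => \sum_b' 2 * (fiber b * fiber b'))%N); last first.
  by move=> b _; rewrite big_distrr.
apply: (@leq_trans (\sum_(b : T) \sum_(b' : T) (fiber b ^ 2 + fiber b' ^ 2))).
  by apply: leq_sum => b _; apply: leq_sum => b' _; exact: nat_Cauchy.
under eq_bigr => b _ do rewrite big_split sum_nat_const.
by rewrite big_split /= -big_distrr sum_nat_const addnn -mul2n.
Qed.

Section Energy.
Context {R : realType} {d k : nat}.
Context (gamma : probability (borel_grassmannian R d k) R) (C : R).
Context (C0 : 0 <= C) (gammaC : forall (w : 'rV[R]_d) m,
  (m = 0%N \/ exists i, 2 ^+ m <= 2 * `|w 0 i|) ->
  (gamma (near_subspaces d%:R w) <= (C * 2 ^- (m * k))%:E)%E).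

Definition in_box m (w : 'rV[R]_d) := [forall i, `|w 0 i| < 2 ^+ m].

(** Only the term of the smallest box containing [w] is used: unless [m = 0], the
    vector [w] is not in the box of half the size, hence has a coordinate of
    absolute value at least [2 ^ m / 2].
    The other terms are there so that the bound can be summed over pairs by
    counting points in boxes. *)
Lemma measure_near_dyadic_sum (w : 'rV[R]_d) n : in_box n w ->
  (gamma (near_subspaces d%:R w) <=
    (\sum_(m < n.+1) C * 2 ^- (m * k) * (in_box m w)%:R)%:E)%E.
Proof.
move=> wn; have exm : exists m, in_box m w by exists n.
case: (ex_minnP exm) => m wm mmin.
have mn : (m < n.+1)%N by rewrite ltnS mmin.
apply: (@le_trans _ _ (C * 2 ^- (m * k))%:E).
  apply: gammaC; case: m wm mmin {mn} => [|m] wm mmin; [by left|right].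
  have /forallPn [i] : ~~ in_box m w.
    by apply/negP => /mmin; rewrite ltnn.
  by rewrite -leNgt => wi; exists i; rewrite exprS ler_pM2l.
rewrite lee_fin (bigD1 (Ordinal mn)) //= wm mulr1 lerDl.
by apply: sumr_ge0 => j _; rewrite !mulr_ge0 ?invr_ge0 ?exprn_ge0.
Qed.

(** A bound for the expected number of colliding pairs, obtained by summing
    [measure_near_dyadic_sum] and counting, for each point, the points in the
    boxes around it. *)
Lemma energy_le (I : finType) (p : I -> 'rV[R]_d) n (B : nat -> R) :
  (forall i j, in_box n (p i - p j)) ->
  (forall i m, (m <= n)%N -> #|[set j | in_box m (p i - p j)]%SET|%:R <= B m) ->
  (\sum_(ij : I * I) gamma (near_subspaces d%:R (p ij.1 - p ij.2)) <=
    (#|I|%:R * (C * \sum_(m < n.+1) 2 ^- (m * k) * B m))%:E)%E.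
Proof.
move=> pn pB.
apply: (@le_trans _ _ (\sum_(ij : I * I)
    (\sum_(m < n.+1) C * 2 ^- (m * k) * (in_box m (p ij.1 - p ij.2))%:R)%:E)%E).
  by apply: lee_sum => ij _; exact: measure_near_dyadic_sum.
rewrite sumEFin lee_fin -(pair_bigA _ (fun i j =>
  \sum_(m < n.+1) C * 2 ^- (m * k) * (in_box m (p i - p j))%:R)) /=.
rewrite mulr_natl -sumr_const; apply: ler_sum => i _.
rewrite exchange_big /= mulr_sumr; apply: ler_sum => m _.
rewrite -mulr_sumr -mulrA ler_wpM2l // ler_wpM2l ?invr_ge0 ?exprn_ge0 //.
apply: le_trans (pB i m _); last by rewrite -ltnS.
rewrite -natr_sum ler_nat -sum1_card [leqRHS]big_mkcond /=.
by apply: leq_sum => j _; rewrite inE; case: in_box.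
Qed.

End Energy.

Section Projection.
Context {R : realType} {d k : nat}.
Implicit Types (P : 'End('rV[R]_d)) (x p q : 'rV[R]_d).

Lemma same_floor_lt1 x y i :
  floor_vec x = floor_vec y -> `|x 0 i - y 0 i| < 1 :> R.
Proof.
move/rowP/(_ i); rewrite !mxE => e; rewrite ltr_distlC.
have := floor_le (x 0 i); have := floor_le (y 0 i).
have := floorD1_gt (x 0 i); have := floorD1_gt (y 0 i).
rewrite !intrD e; set f := _%:~R; move=> h1 h2 h3 h4; apply/andP; split; lra.
Qed.

(** The vector [p - q - P (p - q)] lies in the null space, and [P (p - q)] has
    coordinates smaller than 1, hence squared norm at most [d]. *)
Lemma collision_near P (V : borel_grassmannian R d k) p q :
  projection_onto_coords k P -> lker P = \val (V : grassmannian R d k) ->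
  floor_vec (P p) = floor_vec (P q) -> near_subspaces d%:R (p - q) V.
Proof.
move=> [PP _] kerP fl; exists ((p - q) - P (p - q)).
  by rewrite -kerP memv_ker linearB /= -[P (P _)]comp_lfunE PP subrr.
rewrite opprB addrC subrK -[d in d%:R]card_ord -sumr_const.
apply: ler_sum => i _; rewrite -expr2 -[_ ^+ 2]real_normK ?num_real //.
rewrite expr_le1 // linearB mxE mxE ltW //; exact: same_floor_lt1.
Qed.

Definition sup_norm_bound P (b : nat) : Prop := forall x (t : R),
  (forall i, `|x 0 i| <= t) -> forall i, `|P x 0 i| <= b%:R * t.

(** The sum of the absolute values of the matrix entries, rounded up, serves as
    the bound. *)
Lemma lfun_bound P : exists2 b : nat, (0 < b)%N & sup_norm_bound P b.
Proof.
pose M := lin1_mx P.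
pose s := \sum_(i < d) \sum_(j < d) `|M i j|.
exists (Num.truncn s).+1 => // x t xt i.
have t0 : 0 <= t by apply: le_trans (xt i).
have -> : P x = x *m M by rewrite mul_rV_lin1.
rewrite mxE; apply: le_trans (ler_norm_sum _ _ _) _.
apply: (@le_trans _ _ (s * t)); last by rewrite ler_wpM2r // ltW // truncnS_gt.
rewrite mulr_suml; apply: ler_sum => j _; rewrite normrM mulrC.
apply: ler_pM => //; rewrite (bigD1 i) //= lerDl.
by apply: sumr_ge0.
Qed.

Lemma floor_vec_bounds x i : x 0 i - 1 < floor_vec x 0 i <= x 0 i.
Proof.
rewrite mxE floor_le andbT ltrBlDr; have := floorD1_gt (x 0 i).
by rewrite intrD.
Qed.

End Projection.

(** * Image points of a single projection *)

Section ProjectedCount.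
Context {R : realType} {d k : nat} (A : set 'rV[R]_d).
Context {I : finType} (p : I -> 'rV[R]_d) (n : nat).
Context (Ap : forall i, A (p i))
        (p_close : forall i j, in_box n.+1 (p i - p j)).

Definition collision_sets (ij : I * I) : set (borel_grassmannian R d k) :=
  near_subspaces d%:R (p ij.1 - p ij.2).

Lemma card_sq_le_projected_count (P : 'End('rV[R]_d))
    (V : borel_grassmannian R d k) (b : nat) (i0 : I) :
  projection_onto_coords k P -> lker P = \val (V : grassmannian R d k) ->
  (0 < b)%N -> sup_norm_bound P b ->
  exists a, #|I|%:R ^+ 2 <=
    (cube_count (P @` A) a (8 * b%:R * 2 ^+ n))%:R *
      multiplicity (R := R) collision_sets V.
Proof.
move=> Pk PV b0 Pb; set s := 8 * _ * _.
(* The points are within [2 ^ n.+1] of each other, so their images are within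
   [2 * bn] of [P (p i0)], and rounding moves them by at most [1 <= bn]. *)
pose bn : R := b%:R * 2 ^+ n.
have bn1 : 1 <= bn.
  by rewrite /bn -natrX -natrM ler1n muln_gt0 b0 expn_gt0.
pose a : 'rV[R]_d := P (p i0) - const_mx (4 * bn).
exists a; set T := fset_set (floor_set (P @` A) `&` cube a s).
have hT i : floor_vec (P (p i)) \in T.
  rewrite in_fset_set; last exact: finite_floor_cube.
  rewrite inE; split.
    by exists (P (p i)) => //; exists (p i).
  move=> l; have /andP[f1 f2] := floor_vec_bounds (P (p i)) l.
  have : `|P (p i - p i0) 0 l| <= b%:R * (2 ^+ n.+1).
    by apply: Pb => j; have /forallP/(_ j)/ltW := p_close i i0.
  rewrite linearB !mxE exprS mulrCA -/bn ler_norml => /andP[g1 g2].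
  have sE : s = 8 * bn by rewrite /s mulrA.
  move: f1 f2 g1 g2; rewrite sE !mxE; set x := P (p i) 0 l; set y := P (p i0) 0 l.
  by move=> f1 f2 g1 g2; apply/andP; split; lra.
pose h i : T := [` hT i]%fset.
(* Each colliding pair is counted by [multiplicity], by [collision_near]. *)
have := card_sq_le_collisions h; rewrite -(ler_nat R) natrX => /le_trans; apply.
rewrite natrM -cardfE ler_wpM2l // pair_bigA natr_sum /multiplicity.
apply: ler_sum => -[i j] _ /=; case: eqP => [/(congr1 val) /= hij|_].
  by rewrite indicE mem_set //; exact: collision_near Pk PV hij.
by rewrite indicE ler0n.
Qed.

End ProjectedCount.

Section BoxCount.
Context {R : realType} {d : nat} (A : set 'rV[R]_d).
Context {I : finType} (p : I -> 'rV[R]_d).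

(** Rounding moves a point by less than 1, so a box of half-width [2 ^ m] around
    [p i] is covered, after rounding, by a cube with sides four times as long as
    the half-width. *)
Lemma in_box_cube_count i m :
  (forall j, A (p j)) -> injective (fun j => floor_vec (p j)) ->
  (#|[set j | in_box m (p i - p j)]%SET| <=
     cube_count A (floor_vec (p i) - const_mx (2 ^+ m.+1)) (2 ^+ m.+2))%N.
Proof.
move=> Ap pinj; rewrite cardE -(size_map (fun j => floor_vec (p j))).
apply: uniq_leq_size; first by rewrite map_inj_uniq ?enum_uniq.
move=> _ /mapP [j + ->]; rewrite mem_enum inE => /forallP pj.
rewrite in_fset_set; last exact: finite_floor_cube.
rewrite inE; split; first by exists (p j).
move=> l; have := pj l; have /andP[] := floor_vec_bounds (p i) l.
have /andP[] := floor_vec_bounds (p j) l.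
have : 1 <= 2 ^+ m :> R by rewrite exprn_ege1 // ler1n.
rewrite ltr_norml [(p i - p j) 0 l]mxE [(- p j) 0 l]mxE.
rewrite [(floor_vec (p i) - _) 0 l]mxE [(- const_mx _) 0 l]mxE.
rewrite [const_mx _ 0 l]mxE.
rewrite !exprS; set x := floor_vec (p i) 0 l; set y := floor_vec (p j) 0 l.
set M := 2 ^+ m => M1 h1 h2 h3 h4 /andP[h5 h6]; apply/andP; split; lra.
Qed.

End BoxCount.

(** One point of [A] is chosen above each integer point of the cube; the margin
    [n.+1] absorbs the rounding. *)
Lemma floor_cube_points {R : realType} {d : nat} (A : set 'rV[R]_d) b n :
  exists (I : finType) (p : I -> 'rV[R]_d),
    [/\ #|I| = cube_count A b (2 ^+ n), forall i, A (p i),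
        injective (fun i => floor_vec (p i)) &
        forall i j, in_box n.+1 (p i - p j)].
Proof.
set F := fset_set (floor_set A `&` cube b (2 ^+ n)).
have exp (z : F) : exists x, A x /\ floor_vec x = val z.
  have := fsvalP z; rewrite in_fset_set; last exact: finite_floor_cube.
  by rewrite inE => -[[x Ax xz] _]; exists x.
have [p pP] := choice exp; exists F, p; split.
- by rewrite -cardfE.
- by move=> i; have [] := pP i.
- by move=> i j; have [_ ->] := pP i; have [_ ->] := pP j; exact: val_inj.
move=> i j; apply/forallP => l.
have cF (z : F) : cube b (2 ^+ n) (val z).
  have := fsvalP z; rewrite in_fset_set; last exact: finite_floor_cube.
  by rewrite inE => -[].
have /andP[i1 i2] := cF i l; have /andP[j1 j2] := cF j l.
have := floor_vec_bounds (p i) l; have := floor_vec_bounds (p j) l.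
have [_ ->] := pP i; have [_ ->] := pP j => /andP[h1 h2] /andP[h3 h4].
have M1 : 1 <= 2 ^+ n :> R by rewrite exprn_ege1 // ler1n.
rewrite exprS ltr_norml [(p i - p j) 0 l]mxE [(- p j) 0 l]mxE.
move: i1 i2 j1 j2 h1 h2 h3 h4; set x := val i 0 l; set y := val j 0 l.
by move=> *; apply/andP; split; lra.
Qed.

(** * Projections that are bad at one scale *)

Section Stage.
Context {R : realType} {d k : nat} (k_le_d : (k <= d)%N).
Context (gamma : probability (borel_grassmannian R d k) R)
        (gamma_inv : orthogonal_invariant gamma).
Context (A : set 'rV[R]_d) (alpha : R).

(** At a scale [n] of nearly maximal density, [Bad lam] collects the subspaces
    for which the number of collisions exceeds [lam] times its expected bound.
    The constant [c] depends neither on the scale, nor on [lam], nor on the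
    projection, so that the same projection can be tested at infinitely many
    scales. *)
Lemma exceptional_sets : 0 <= alpha -> alpha <> k%:R ->
  (0 < counting_measure alpha A)%E ->
  exists2 c : R, 0 < c &
    forall n0, exists n (Bad : R -> set (borel_grassmannian R d k)),
    [/\ (n0 <= n)%N,
        forall lam, 0 < lam ->
          measurable (Bad lam) /\ (gamma (Bad lam) <= (lam^-1)%:E)%E &
        forall lam V (P : 'End('rV[R]_d)) (b : nat), 0 < lam -> ~ Bad lam V ->
          projection_onto_coords k P -> lker P = \val (V : grassmannian R d k) ->
          (0 < b)%N -> sup_norm_bound P b ->
          exists a, c / lam * (2 `^ Order.min k%:R alpha) ^+ n <=
            (cube_count (P @` A) a (8 * b%:R * 2 ^+ n))%:R].
Proof.
move=> al0 alk dA.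
have [C C1 gC] := measure_near_subspaces_le k_le_d gamma_inv.
have C_gt0 : 0 < C by apply: lt_le_trans C1.
have [c c_gt0 dyadic] := counting_measure_gt0_dyadic al0 dA.
(* [q] is the ratio of the geometric series of the energy; dividing [rho] by
   [max 1 q] turns the growth rate [2 ^ alpha] of the number of points into that
   of the number of image points. *)
pose rho : R := 2 `^ alpha; pose L : R := 2 ^+ k; pose q := rho / L.
have rho_gt0 : 0 < rho by exact: powR_gt0.
have rho_ge1 : 1 <= rho by rewrite -(powRr0 2) ler_powR // ler1n.
have L_gt0 : 0 < L by rewrite exprn_gt0.
have LE : L = 2 `^ k%:R by rewrite powR_mulrn.
have q_gt0 : 0 < q by exact: divr_gt0.
have growth_min : rho / Order.max 1 q = 2 `^ Order.min k%:R alpha.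
  have [ak|ka] := leP k%:R alpha.
    rewrite max_r; first by rewrite /q invf_div mulrCA divff ?mulr1 // gt_eqF.
    by rewrite /q ler_pdivlMr // mul1r LE ler_powR // ler1n.
  rewrite max_l; first by rewrite divr1.
  by rewrite /q ler_pdivrMr // mul1r LE ler_powR ?ler1n // ltW.
have q_neq1 : q != 1.
  apply/eqP => q1; apply: alk; have rhoL : rho = L.
    by rewrite -(divfK (lt0r_neq0 L_gt0) rho) -/q q1 mul1r.
  move: rhoL; rewrite /rho LE => /(congr1 (@ln R)); rewrite !ln_powR.
  move=> /mulIf; apply.
  by rewrite gt_eqF // ln_gt0 // ltr1n.
have [c' c'_gt0 geo] := geometric_sum_le q_gt0 q_neq1.
have [b bmax] := choice (fun m => max_cube_count A (2 ^+ m)).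
pose u m : R := (cube_count A (b m) (2 ^+ m))%:R / rho ^+ m.
have uE m : (cube_count A (b m) (2 ^+ m))%:R = u m * rho ^+ m.
  by rewrite divfK // expf_neq0 // gt_eqF.
have u_large n0 : exists n, (n0 <= n)%N /\ c <= u n.
  have [n [a [n0n ca]]] := dyadic n0; exists n; split => //.
  rewrite /u ler_pdivlMr ?exprn_gt0 //; apply: le_trans ca _.
  by rewrite ler_nat.
have [kappa /andP[kappa_gt0 kappa_le1] record] :=
  near_record_indices c_gt0 u_large.
exists (kappa / (C * rho ^+ 2 * c')).
  by rewrite divr_gt0 // !mulr_gt0 ?exprn_gt0 //.
move=> n0; have [n [n0n un0 urec]] := record n0.
pose H := u n / kappa.
have uH j : (j <= n)%N -> u j <= H.
  by move=> /urec h; rewrite ler_pdivlMr // mulrC.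
have H_gt0 : 0 < H by exact: divr_gt0.
have unE : u n = kappa * H by rewrite /H mulrCA divff ?mulr1 // gt_eqF.
clearbody H.
have [I [p [cardI Ap pinj pclose]]] := floor_cube_points A (b n) n.
have cardI_E : #|I|%:R = kappa * H * rho ^+ n :> R.
  by rewrite cardI uE unE.
have cardI_gt0 : 0 < #|I|%:R :> R by rewrite cardI_E !mulr_gt0 ?exprn_gt0 //.
pose B m := H * rho ^+ m.+2.
have count_le i m : (m <= n.+1)%N ->
    #|[set j | in_box m (p i - p j)]%SET|%:R <= B m.
  (* Above scale [n] the total number of points is a good enough bound. *)
  move=> _; have [mn|nm] := leqP m.+2 n.
    apply: (@le_trans _ _ (cube_count A (b m.+2) (2 ^+ m.+2))%:R).
      by rewrite ler_nat (leq_trans (in_box_cube_count i m Ap pinj)).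
    by rewrite uE ler_wpM2r ?uH // exprn_ge0 // ltW.
  apply: (@le_trans _ _ (#|I|%:R)); first by rewrite ler_nat max_card.
  rewrite cardI uE /B.
  apply: ler_pM; rewrite ?uH ?(ltW un0) ?exprn_ge0 ?(ltW rho_gt0) //.
  by rewrite ler_weXn2l // ltnW.
pose events := collision_sets (k := k) p.
pose D := C * (H * rho ^+ 2 * (c' * Order.max 1 q ^+ n)).
have max_gt0 : 0 < Order.max 1 q by rewrite lt_max ltr01.
have D_gt0 : 0 < D by rewrite !mulr_gt0 ?exprn_gt0 //.
have energy : (\sum_(ij : I * I) gamma (events ij) <= (#|I|%:R * D)%:E)%E.
  apply: le_trans (energy_le (ltW C_gt0) gC pclose count_le) _.
  rewrite lee_fin ler_pM2l // ler_pM2l //.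
  have -> : \sum_(m < n.+2) 2 ^- (m * k) * B m =
            H * rho ^+ 2 * \sum_(m < n.+2) q ^+ m.
    rewrite mulr_sumr; apply: eq_bigr => m _.
    rewrite /B /q expr_div_n -exprM mulnC exprS exprS.
    ring.
  by rewrite ler_pM2l ?geo // mulr_gt0 ?exprn_gt0 //.
have mU ij : measurable (events ij) by exact: measurable_near_subspaces.
exists n, (fun lam => [set V | lam * (#|I|%:R * D) < multiplicity events V]).
split=> // [lam lam0|lam V P bP lam0 /negP good Pk PV b0 Pb].
  split; first exact: measurable_multiplicity_gt.
  by apply: multiplicity_markov => //; exact: mulr_gt0.
have [i0 _] : exists i0 : I, true.
  by move: cardI_gt0; rewrite ltr0n => /card_gt0P [i0 _]; exists i0.
have [a le_a] := card_sq_le_projected_count Ap pclose i0 Pk PV b0 Pb.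
exists a; move: good; rewrite -leNgt => good.
set N := (cube_count _ _ _)%:R in le_a *.
(* Dividing by [#|I|] and by [lam * D], in which [H] cancels. *)
have : #|I|%:R ^+ 2 <= N * (lam * (#|I|%:R * D)).
  by apply: (le_trans le_a); rewrite ler_wpM2l.
rewrite (_ : N * _ = #|I|%:R * (N * (lam * D))); last by ring.
rewrite expr2 ler_pM2l // cardI_E -growth_min => main.
have lD : 0 < lam * D by exact: mulr_gt0.
rewrite -(ler_pM2r lD); apply: le_trans main; rewrite le_eqVlt; apply/orP; left.
apply/eqP; rewrite /D expr_div_n; field.
by rewrite !gt_eqF // exprn_gt0.
Qed.

End Stage.

(** * Almost every projection *)

Section AlmostEvery.
Context {disp : measure_display} {T : measurableType disp} {R : realType}.
Context (P : probability T R).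

(** For each [i], the sets of points that are bad from stage [N] on increase
    with [N] and have measure at most [1 / i.+1], hence so has their union. *)
Lemma negligible_eventually_bad (Bad : nat -> nat -> set T) :
  (forall j i, measurable (Bad j i) /\ (P (Bad j i) <= (i.+1%:R^-1)%:E)%E) ->
  P.-negligible (\bigcap_i \bigcup_N \bigcap_(j >= N) Bad j i).
Proof.
move=> bad; pose W i := \bigcup_N \bigcap_(j >= N) Bad j i.
have mI N i : measurable (\bigcap_(j >= N) Bad j i).
  by apply: bigcap_measurable => [|j _]; [exists N => /=|have [] := bad j i].
have mW i : measurable (W i) by apply: bigcup_measurable.
have W_le i : (P (W i) <= (i.+1%:R^-1)%:E)%E.
  have cvgW : P (\bigcap_(j >= N) Bad j i) @[N --> \oo] --> P (W i).
    apply: nondecreasing_cvg_mu => // [|N N' NN'].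
      exact: mW.
    by apply/subsetPset => t h j /= N'j; apply: h; exact: leq_trans NN' N'j.
  rewrite -(cvg_lim _ cvgW) //; apply: lime_le.
    by apply/cvg_ex; exists (P (W i)).
  near=> N; have [mB B_le] := bad N i; apply: le_trans B_le.
  by apply: le_measure; rewrite ?inE // => t; apply => /=.
have mcap : measurable (\bigcap_i W i) by apply: bigcapT_measurable.
exists (\bigcap_i W i); split => //.
apply/eqP; rewrite eq_le measure_ge0 andbT; apply/lee_addgt0Pr => e e0.
rewrite add0e; have [i ie] : exists i, i.+1%:R^-1 <= e.
  exists (Num.truncn e^-1); rewrite -[leRHS]invrK lef_pV2 ?posrE ?invr_gt0 //.
  exact: ltW (truncnS_gt _).
apply: (@le_trans _ _ (P (W i))).
  by apply: le_measure; rewrite ?inE // => t; apply.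
by apply: le_trans (W_le i) _; rewrite lee_fin.
Unshelve. all: by end_near. Qed.

End AlmostEvery.

Section Marstrand.
Context {R : realType} {d k : nat} (k_le_d : (k <= d)%N).
Context (gamma : probability (borel_grassmannian R d k) R)
        (gamma_inv : orthogonal_invariant gamma).
Context (A : set 'rV[R]_d).

(** A projection outside the negligible set is, for some [i], not bad with
    [lam = i.+1] at infinitely many scales.  Its operator bound [b] enters only
    the constant, which may depend on the projection. *)
Lemma ae_counting_measure_projection alpha : 0 <= alpha -> alpha <> k%:R ->
  (0 < counting_measure alpha A)%E ->
  ae_projection gamma (fun P : 'End('rV[R]_d) =>
    (0 < counting_measure (Order.min k%:R alpha) (P @` A))%E).
Proof.
move=> al0 alk dA; set mu := Order.min _ _.
have mu0 : 0 <= mu by rewrite le_min ler0n.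
have [c c0 stage] := exceptional_sets k_le_d gamma_inv al0 alk dA.
have [nn nnP] := choice stage; have [Bad BadP] := choice nnP.
pose bad j i := Bad j i.+1%:R.
have : gamma.-negligible (\bigcap_i \bigcup_N \bigcap_(j >= N) bad j i).
  by apply: negligible_eventually_bad => j i; have [_ + _] := BadP j; apply.
apply: negligibleS => V /= /existsNP [P] /not_implyP [Pk] /not_implyP [PV].
move=> nP i _; apply: contrapT => /= nW; apply: nP.
have [b b0 Pb] := lfun_bound P.
have b_gt0 : 0 < 8 * b%:R :> R by rewrite mulr_gt0 // ltr0n.
have i0 : 0 < i.+1%:R :> R by rewrite ltr0n.
have s0 n : 0 < 8 * b%:R * 2 ^+ n :> R by rewrite mulr_gt0 ?exprn_gt0.
apply: (@counting_measure_gt0_intro _ _ _ _ (c / i.+1%:R / (8 * b%:R) `^ mu)).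
  by rewrite !divr_gt0 // powR_gt0.
move=> l; pose N := (Num.truncn l).+1.
have [j Nj nbad] : exists2 j, (N <= j)%N & ~ bad j i V.
  apply: contrapT => h; apply: nW; exists N => // j /= Nj.
  by apply: contrapT => nb; apply: h; exists j.
have [jn _ /(_ _ V P b i0 nbad Pk PV b0 Pb) [a le_a]] := BadP j.
exists a, (8 * b%:R * 2 ^+ nn j); split => //.
  apply: (@le_trans _ _ (2 ^+ nn j)).
    apply: (le_trans (ltW (truncnS_gt l))); rewrite -natrX ler_nat -/N.
    exact: leq_trans (leq_trans Nj jn) (ltnW (ltn_expl _ _)).
  by rewrite ler_peMl ?exprn_ge0 // -natrM ler1n muln_gt0.
have pM := powRM mu (ltW b_gt0) (exprn_ge0 (nn j) (ler0n R 2)).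
apply: le_trans le_a; rewrite pM.
rewrite mulrA divfK ?gt_eqF ?powR_gt0 //.
by rewrite -!powR_mulrn ?powR_ge0 // -!powRrM [_ * mu]mulrC.
Qed.

Lemma ae_counting_dim_projection :
  ae_projection gamma (fun P : 'End('rV[R]_d) =>
    (Order.min (k%:R)%:E (counting_dim A) <= counting_dim (P @` A))%E).
Proof.
set m := Order.min _ _.
have D_ge0 : (0 <= counting_dim A)%E.
  by apply: le_ereal_inf_tmp => _ [al [al0 _] <-]; rewrite lee_fin.
have m_ge0 : (0 <= m)%E by rewrite /m le_min D_ge0 lee_fin ler0n.
have m_lek : (m <= k%:R%:E)%E by rewrite /m ge_min lexx.
have m_leD : (m <= counting_dim A)%E by rewrite /m ge_min lexx orbT.
clearbody m; move: m m_ge0 m_lek m_leD => [m| |]; rewrite ?lee_fin //.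
move=> m_ge0 m_lek m_leD.
(* A negligible set is available for each exponent, so countably many exponents
   must suffice. *)
pose al j : R := m - j.+1%:R^-1.
have al_lt j : al j < m by rewrite /al ltrBlDr ltrDl invr_gt0 ltr0n.
have ae_al : {ae gamma, forall V : borel_grassmannian R d k,
    forall j, 0 <= al j -> forall P : 'End('rV[R]_d),
      projection_onto_coords k P -> lker P = \val (V : grassmannian R d k) ->
      (0 < counting_measure (al j) (P @` A))%E}.
  apply/ae_foralln => j; have [al0|al_neg] := leP 0 (al j); last first.
    by apply: aeW => V.
  have al_k : al j < k%:R by apply: lt_le_trans m_lek.
  have al_neq : al j <> k%:R by move=> e; rewrite e ltxx in al_k.
  have dA : (0 < counting_measure (al j) A)%E.
    rewrite lt_def counting_measure_ge0 andbT; apply/eqP => d0.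
    have : (counting_dim A <= (al j)%:E)%E.
      by apply: ereal_inf_lbound; exists (al j).
    by move/(le_trans m_leD); rewrite lee_fin leNgt al_lt.
  have := ae_counting_measure_projection al0 al_neq dA.
  rewrite /ae_projection => aeP.
  by apply: filterS aeP => V h _ P Pk PV; have := h P Pk PV; rewrite min_r // ltW.
apply: filterS ae_al => V h P Pk PV.
apply: le_ereal_inf_tmp => _ [be [be0 dbe] <-].
rewrite lee_fin leNgt; apply/negP => be_m.
pose j := Num.truncn (m - be)^-1.
have be_al : be <= al j.
  rewrite /al lerBrDl -lerBrDr -[leRHS]invrK.
  rewrite lef_pV2 ?posrE ?invr_gt0 ?subr_gt0 //.
  exact: ltW (truncnS_gt _).
have := h j (le_trans be0 be_al) P Pk PV.
rewrite ltNge; apply/negP; rewrite negbK -dbe.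
exact: counting_measure_antitone.
Qed.

Lemma ae_counting_measure_projection_large : (k%:R%:E < counting_dim A)%E ->
  ae_projection gamma (fun P : 'End('rV[R]_d) =>
    (0 < counting_measure k%:R (P @` A))%E).
Proof.
move=> kD.
have [al kal alD] : exists2 al : R, k%:R < al & (al%:E < counting_dim A)%E.
  move: kD; case: (counting_dim A) => [D| |] // kD.
    by exists ((k%:R + D) / 2); rewrite ?lte_fin; move: kD; rewrite lte_fin; lra.
  by exists (k%:R + 1); rewrite ?ltry // ltrDl.
have al0 : 0 <= al by apply: le_trans (ler0n R k) (ltW kal).
have al_neq : al <> k%:R by move=> e; rewrite e ltxx in kal.
have dA : (0 < counting_measure al A)%E.
  rewrite lt_def counting_measure_ge0 andbT; apply/eqP => d0.
  by move: alD; apply/negP; rewrite -leNgt; apply: ereal_inf_lbound; exists al.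
have := ae_counting_measure_projection al0 al_neq dA.
rewrite /ae_projection => aeP.
by apply: filterS aeP => V h P Pk PV; have := h P Pk PV; rewrite min_l // ltW.
Qed.

End Marstrand.

Unset Implicit Arguments.

Theorem theoremC (R : realType) (d k : nat) (k_le_d : (k <= d)%N)
    (gamma : probability (borel_grassmannian R d k) R)
    (gamma_inv : orthogonal_invariant gamma)
    (A : set 'rV[R]_d) :
  (forall alpha : R, 0 <= alpha -> alpha <> k%:R ->
     (0 < counting_measure alpha A)%E ->
     ae_projection gamma (fun P : 'End('rV[R]_d) =>
       (0 < counting_measure (Order.min k%:R alpha) (P @` A))%E)) /\
  ae_projection gamma (fun P : 'End('rV[R]_d) =>
    (Order.min (k%:R)%:E (counting_dim A) <= counting_dim (P @` A))%E) /\
  ((k%:R%:E < counting_dim A)%E ->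
   ae_projection gamma (fun P : 'End('rV[R]_d) =>
     (0 < counting_measure k%:R (P @` A))%E)).
Proof.
split; first by move=> alpha; exact: ae_counting_measure_projection.
split; first exact: ae_counting_dim_projection.
exact: ae_counting_measure_projection_large.
Qed.
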